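(* Let $f,g:S^1\to S^1$ be maps of degrees $a,b\in\mathbb Z$ respectively. Then the pair $f,g$ is coincidence essentially reducible to the gcd if and only if $\gcd(a,b)=1$.
   Context: Maps are continuous and $f^n$ denotes the $n$-th iterate. Let $X=S^1$ with base point $x_0$; the maps $f,g$ are taken (without loss of generality, up to homotopy) to preserve $x_0$, with induced homomorphisms $f_*,g_*:\pi_1(X,x_0)\to\pi_1(X,x_0)$ (multiplication by $a$ and $b$ on $\mathbb Z$; they commute). Geometric classes: $\Phi(f^n,g^n)=\{x\in X: f^n(x)=g^n(x)\}$. Points $x,y\in\Phi(f^n,g^n)$ are Nielsen equivalent at level $n$ if there is a path $c$ from $x$ to $y$ with $f^n(c)\simeq g^n(c)$ relative to end points. Each Nielsen class $\mathbf A^n$ has an integer $\mathrm{ind}(\mathbf A^n)$, its coincidence index. Algebraic classes: $\mathcal R(f_*^n,g_*^n)$ is the set of Reidemeister classes $[\alpha]^n$, i.e. equivalence classes of $\pi_1(X,x_0)$ under (written additively) $\alpha\sim\beta$ iff $\alpha=g_*^n(\gamma)+\beta-f_*^n(\gamma)$ for some $\gamma\in\pi_1(X,x_0)$. There is an injection $\rho_n$ from Nielsen classes to $\mathcal R(f_*^n,g_*^n)$ given by $\rho_n(\mathbf A^n)=[g^n(c)f^n(c^{-1})]^n$, where $c$ is any path from $x_0$ to any $x\in\mathbf A^n$. Put $\mathrm{Ind}([\alpha]^n)=\mathrm{ind}(\mathbf A^n)$ if $[\alpha]^n=\rho_n(\mathbf A^n)$ and $\mathrm{Ind}([\alpha]^n)=0$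 otherwise. A class $[\alpha]^n$ is essential if $\mathrm{Ind}([\alpha]^n)\neq0$; $\mathcal E(f^n,g^n)\subseteq\mathcal R(f_*^n,g_*^n)$ is the set of essential classes. Boosting: for $m\mid n$, $\iota_{m,n}:\mathcal R(f_*^m,g_*^m)\to\mathcal R(f_*^n,g_*^n)$ is induced by $$\iota_{m,n}(\alpha)=g_*^{n-m}(\alpha)+g_*^{n-2m}f_*^{m}(\alpha)+\cdots+g_*^{m}f_*^{n-2m}(\alpha)+f_*^{n-m}(\alpha).$$ $[\alpha]^n$ reduces to $[\beta]^m$ if $m\mid n$ and $\iota_{m,n}([\beta]^m)=[\alpha]^n$. The pair $f,g$ is coincidence essentially reducible if, for every essential class $[\alpha]^n$ (any $n$), whenever $[\alpha]^n$ reduces to $[\beta]^m$, the class $[\beta]^m$ is also essential. The pair $f,g$ is coincidence essentially reducible to the gcd if it is coincidence essentially reducible and, whenever $[\alpha]^n\in\mathcal E(f^n,g^n)$ reduces to both $[\beta]^m\in\mathcal E(f^m,g^m)$ and $[\gamma]^k\in\mathcal E(f^k,g^k)$, there is a $[\delta]^d\in\mathcal E(f^d,g^d)$ with $d=\gcd(m,k)$ to which both $[\beta]^m$ and $[\gamma]^k$ reduce.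
   Formalization: Pairs of equal degrees a = b with |a| ≠ 1 are excluded: there all coincidence indices vanish, no class is essential, so the pair is vacuously essentially reducible to the gcd although gcd(a,b) = |a| ≠ 1, and the printed equivalence fails. *)

(* Defs.v *)
From HB Require Import structures.
From mathcomp Require Import all_boot all_order all_algebra.
From mathcomp Require Import all_classical all_reals all_analysis.
From mathcomp Require Import ring.

Set Implicit Arguments.
Unset Strict Implicit.
Unset Printing Implicit Defensive.

Import Order.TTheory GRing.Theory Num.Theory.
Import numFieldNormedType.Exports.

Local Open Scope classical_set_scope.
Local Open Scope ring_scope.

(* A path is a function on the whole line of which only the restriction to
   [0, 1] matters.  An element of the fundamental group is represented by a
   loop, equality in that group being [path_homotopic] and the group law (which
   is written additively in the literature on S^1) being [path_cat]. *)
Section Paths.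
Context {R : realType} {X : topologicalType}.
Implicit Types (c d : R -> X) (x y : X).

Definition is_path x y c : Prop :=
  [/\ {within `[0, 1], continuous c}, c 0 = x & c 1 = y].

Definition path_rev c : R -> X := fun t => c (1 - t).

Definition path_cat c d : R -> X :=
  fun t => if t <= 2^-1 then c (2 * t) else d (2 * t - 1).

(* The first coordinate of H is the homotopy parameter. *)
Definition path_homotopic c d : Prop :=
  exists H : R * R -> X,
    [/\ {within `[0, 1] `*` `[0, 1], continuous H},
        forall t, t \in `[0, 1] -> H (0, t) = c t /\ H (1, t) = d t &
        forall s, s \in `[0, 1] -> H (s, 0) = c 0 /\ H (s, 1) = c 1].

End Paths.

Section Classes.
Context {R : realType} {X : topologicalType}.
Variables (f g : X -> X) (x0 : X).
Implicit Types (n m : nat) (alpha beta gamma : R -> X).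

Definition coincidences n : set X := [set x | iter n f x = iter n g x].

Definition nielsen_equiv n (x y : X) : Prop :=
  exists2 c : R -> X, is_path x y c &
    path_homotopic (iter n f \o c) (iter n g \o c).

Definition nielsen_class n (A : set X) : Prop :=
  exists2 x, coincidences n x &
    A = [set y | coincidences n y /\ nielsen_equiv n x y].

(* alpha ~ beta iff alpha = g^n(gamma) + beta - f^n(gamma) for some gamma *)
Definition reidemeister_equiv n alpha beta : Prop :=
  exists2 gamma : R -> X, is_path x0 x0 gamma &
    path_homotopic alpha
      (path_cat (iter n g \o gamma)
         (path_cat beta (iter n f \o path_rev gamma))).

Definition reidemeister_class n alpha : set (R -> X) :=
  [set beta | is_path x0 x0 beta /\ reidemeister_equiv n alpha beta].

Definition reidemeister n : set (set (R -> X)) :=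
  [set C | exists2 alpha, is_path x0 x0 alpha & C = reidemeister_class n alpha].

(* The graph of the injection from Nielsen classes to Reidemeister classes. *)
Definition nielsen_to_reidemeister n (A : set X) (C : set (R -> X)) : Prop :=
  exists x c, [/\ A x, is_path x0 x c &
    C = reidemeister_class n
          (path_cat (iter n g \o c) (iter n f \o path_rev c))].

(* g^(n-m)(alpha) + g^(n-2m) f^m (alpha) + ... + f^(n-m)(alpha) *)
Definition boost m n alpha : R -> X :=
  foldr path_cat (cst x0)
    [seq iter (n - m * i.+1)%N g \o iter (m * i)%N f \o alpha
       | i <- iota 0 (n %/ m)].

(* [reduces n D m C]: the class D of level n reduces to the class C of
   level m. *)
Definition reduces n (D : set (R -> X)) m (C : set (R -> X)) : Prop :=
  (m %| n)%N /\
  exists alpha, [/\ is_path x0 x0 alpha, C = reidemeister_class m alpha &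
                    D = reidemeister_class n (boost m n alpha)].

End Classes.

Section Circle.
Context {R : realType}.

Definition circle : set (R * R) := [set p | p.1 ^+ 2 + p.2 ^+ 2 = 1].

Lemma circle_expP (t : R) : circle (cos (2 * pi * t), sin (2 * pi * t)).
Proof. exact: cos2Dsin2. Qed.

Definition circle_exp (t : R) : circle :=
  SigSub (mem_set (circle_expP t)).

Lemma circle_divP (z w : circle) :
  circle ((val z).1 * (val w).1 + (val z).2 * (val w).2,
          (val z).2 * (val w).1 - (val z).1 * (val w).2).
Proof.
case: z w => [[a b] /= /set_mem /= zE] [[c d] /= /set_mem /= wE].
rewrite /circle /=.
transitivity ((a ^+ 2 + b ^+ 2) * (c ^+ 2 + d ^+ 2)).
  by rewrite !expr2; ring.
by rewrite zE wE mulr1.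
Qed.

(* The quotient z / w of unit complex numbers, i.e. z times the conjugate
   of w. *)
Definition circle_div (z w : circle) : circle :=
  SigSub (mem_set (circle_divP z w)).

Definition has_degree (f : circle -> circle) (k : int) : Prop :=
  exists F : R -> R, [/\ continuous F,
    forall t, f (circle_exp t) = circle_exp (F t) &
    forall t, F (t + 1) = F t + k%:~R].

(* Let phi = g / f, so that f and g coincide exactly where phi = 1.  The
   coincidence index of a set A that is open and compact in the coincidence set
   is the image of the fundamental class under
     H_1(S^1) -> H_1(S^1, S^1 - A) = H_1(U, U - A) -> H_1(S^1, S^1 - 1) = Z,
   where U is a neighbourhood of A with no other coincidence, the equality is
   excision and the second map is phi.  If psi is equal to phi near A and takes
   the value 1 exactly on A then phi may be replaced by psi and the composite
   is the degree of psi.  Such a psi always exists (extend phi into the arc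
   S^1 - 1).  With this orientation the indices add up to deg g - deg f, and
   g = id gives the fixed point index of f. *)
Definition coincidence_index (f g : circle -> circle) (A : set circle) : int :=
  xget 0 [set k | exists psi : circle -> circle,
    [/\ continuous psi,
        psi @^-1` [set circle_exp 0] = A,
        forall x, A x -> \forall y \near x, psi y = circle_div (g y) (f y) &
        has_degree psi k]].

Variables (f g : circle -> circle) (x0 : circle).
Implicit Types (n m k : nat) (B C D : set (R -> circle)).

(* The value is 0 when C is not the image of a Nielsen class. *)
Definition reidemeister_index n C : int :=
  xget 0 [set i | exists A, [/\ nielsen_class (R := R) f g n A,
    nielsen_to_reidemeister f g x0 n A C &
    i = coincidence_index (iter n f) (iter n g) A]].

Definition essential n C : Prop :=
  reidemeister f g x0 n C /\ reidemeister_index n C <> 0.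

Definition essentially_reducible : Prop :=
  forall n D m C, (0 < n)%N -> essential n D ->
    reduces f g x0 n D m C -> essential m C.

Definition essentially_reducible_to_gcd : Prop :=
  essentially_reducible /\
  forall n D m B k C, (0 < n)%N ->
    essential n D -> essential m B -> essential k C ->
    reduces f g x0 n D m B -> reduces f g x0 n D k C ->
    exists E, [/\ essential (gcdn m k) E,
                  reduces f g x0 m B (gcdn m k) E &
                  reduces f g x0 k C (gcdn m k) E].

End Circle.

Arguments circle : clear implicits.

(* Main.v *)
Require Import Defs.
From mathcomp Require Import all_boot all_order all_algebra.
From mathcomp Require Import all_classical all_reals all_analysis.
From mathcomp Require Import ring lra zify.

Set Implicit Arguments.
Unset Strict Implicit.
Unset Printing Implicit Defensive.

Import Order.TTheory GRing.Theory Num.Theory.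
Import numFieldNormedType.Exports.

Local Open Scope classical_set_scope.
Local Open Scope ring_scope.

(** Fix lifts [F] and [G] of [f] and [g] to the line that fix a point [t0] over
    the base point.  The difference [G^n - F^n] of the iterated lifts grows by
    [N_n = b^n - a^n] over a period, and it is integral exactly over the
    coincidences of [f^n] and [g^n].

    A path in the circle lifts to the line, and two paths with a common start are
    homotopic exactly if lifts with a common start have a common end
    ([path_homotopicP], from [square_lift]).  Hence loops are classified by their
    winding numbers, the Reidemeister classes of level [n] are the residues
    modulo [N_n], and boosting from level [m] to level [n] is multiplication by
    [N_n / N_m].  In the same way, the Nielsen classes of level [n] are the images
    in the circle of the level sets [G^n - F^n = r] with [r] an integer.  The
    index of such a class is the sign of [N_n] ([coincidence_index_fiber]): if
    [N_n = 0] the function [G^n - F^n] is periodic, so that its crossings of [r]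
    cancel, and otherwise it crosses the translates [r + N_n * k] in total once
    per period.  If [N_n <> 0] every residue is
    attained, so a Reidemeister class of level [n] is essential if and only if
    [N_n <> 0] ([essentialP]).

    The rest is arithmetic.  As [N_m] divides [N_n] whenever [m] divides [n], the
    pair is always essentially reducible.  Embed the residues modulo [N_n <> 0]
    into the rationals modulo 1 by division by [N_n]; boosting becomes the
    identity.  Reducibility to the gcd then says that a rational number modulo 1
    that is killed by [N_m] and by [N_k] is killed by [N_d], where [d] is the gcd
    of [m] and [k].  If [a] and [b] are coprime then [N_d] is the gcd of [N_m] and
    [N_k] up to sign ([power_diff_gcd_lift]).  If a number [p > 1] divides both
    degrees, and these differ, then a high power of [p] divides [N_m] and [N_k]
    for all large [m] and [k], but not [N_1], which is not 0; this contradicts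
    reducibility for coprime odd levels [m] and [k] ([power_diff_no_lift]). *)

(** * The covering of the circle by the line *)

Section CircleExp.
Context {R : realType}.
Implicit Types (s t u v : R) (z w : circle R).

Lemma circle_eq z w :
  (val z).1 = (val w).1 -> (val z).2 = (val w).2 -> z = w.
Proof.
move=> e1 e2; apply: val_inj.
by case: (val z) (val w) e1 e2 => [? ?] [? ?] /= -> ->.
Qed.

Lemma circleE z : (val z).1 ^+ 2 + (val z).2 ^+ 2 = 1.
Proof. by case: z => p /= /set_mem. Qed.

Lemma circle_val_continuous : continuous (fun z : circle R => val z).
Proof. exact: (@initial_continuous (circle R) _ set_val). Qed.

Lemma circle_exp_continuous : continuous (@circle_exp R).
Proof.
apply: continuous_comp_initial => t /=.
have c2 : {for t, continuous (fun t : R => 2 * pi * t)}.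
  exact: mulrl_continuous.
apply: (@cvg_pair _ _ _ _ (nbhs _) (nbhs _) _ _ _
  (fun t => cos (2 * pi * t)) (fun t => sin (2 * pi * t))).
- by apply: continuous_comp; [exact: c2 | exact: continuous_cos].
- by apply: continuous_comp; [exact: c2 | exact: continuous_sin].
Qed.

Lemma circle_divE s t :
  circle_div (circle_exp s) (circle_exp t) = circle_exp (s - t).
Proof.
by apply: circle_eq => /=; rewrite !mulrBr ?cosB ?sinB.
Qed.

Lemma circle_exp_surj z : exists t, circle_exp t = z.
Proof.
have zE := circleE z; set x := (val z).1 in zE; set y := (val z).2 in zE.
have x1 : -1 <= x <= 1 by apply/andP; split; nra.
have ss : Num.sqrt (1 - x ^+ 2) = `|y| by rewrite -zE addrC addKr sqrtr_sqr.
have p0 : 2 * pi != 0 :> R by rewrite mulf_neq0 ?pnatr_eq0 ?gt_eqF ?pi_gt0.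
have [y0|y0] := leP 0 y.
  exists (acos x / (2 * pi)); apply: circle_eq => /=;
    rewrite mulrCA divff // mulr1; first exact: acosK.
  by rewrite sin_acos // ss ger0_norm.
exists (- acos x / (2 * pi)); apply: circle_eq => /=;
  rewrite mulrCA divff // mulr1; first by rewrite cosN; exact: acosK.
by rewrite sinN sin_acos // ss ltr0_norm // opprK.
Qed.

Lemma circle_expD_nat t n : circle_exp (t + n%:R) = circle_exp t.
Proof.
elim: n => [|n IH]; first by rewrite addr0.
rewrite -IH -[n.+1]addn1 natrD addrA; apply: circle_eq => /=.
  by rewrite [in LHS]mulrDr mulr1 mulr2n mulrDl mul1r -mulr2n cosD2pi.
by rewrite [in LHS]mulrDr mulr1 mulr2n mulrDl mul1r -mulr2n sinD2pi.
Qed.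

Lemma circle_expD_int t (k : int) : circle_exp (t + k%:~R) = circle_exp t.
Proof.
case: k => n; first exact: circle_expD_nat.
by rewrite -(circle_expD_nat _ n.+1) NegzE mulrNz subrK.
Qed.

(** Subtracting the floor leaves [v] in [0, 1), and the half-angle formula
    turns [cos (2 pi v) = 1] into [sin (pi v) = 0], which forces [v = 0]. *)
Lemma circle_exp_eq s t :
  circle_exp s = circle_exp t <-> exists k : int, s = t + k%:~R.
Proof.
split=> [est|[k ->]]; last exact: circle_expD_int.
pose k := Num.floor (s - t); exists k.
pose v := s - t - k%:~R.
have v0 : 0 <= v by rewrite subr_ge0 floor_le_tmp.
have v1 : v < 1.
  by rewrite ltrBlDl -intrD1 floorD1_gt.
have : circle_exp v = circle_exp 0.
  by rewrite /v -mulrNz circle_expD_int -circle_divE est circle_divE subrr.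
move/(congr1 (fun z : circle R => (val z).1)) => /=.
have -> : 2 * pi * v = (pi * v) *+ 2 by rewrite -mulr_natl; ring.
rewrite mulr0 cos0 cos_mulr2n => cv.
have sv : sin (pi * v) = 0.
  by apply/eqP; rewrite -sqrf_eq0 sin2cos2; apply/eqP; move: cv; lra.
have [v00|vn] := eqVneq v 0; first by move: v00; rewrite /v; lra.
have : 0 < sin (pi * v).
  have vp : 0 < v by rewrite lt_neqAle eq_sym vn.
  have := pi_gt0 R => pp.
  by apply: sin_gt0_pi; apply/andP; split; nra.
by rewrite sv ltxx.
Qed.

Lemma circle_exp_div z w u v :
  circle_div w z = circle_exp v -> z = circle_exp u -> w = circle_exp (u + v).
Proof.
move=> + zE; have [s <-] := circle_exp_surj w.
rewrite zE circle_divE => /circle_exp_eq[k e].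
by apply/circle_exp_eq; exists k; move: e; lra.
Qed.

Lemma circle_divzz z : circle_div z z = circle_exp 0.
Proof. by have [s <-] := circle_exp_surj z; rewrite circle_divE subrr. Qed.

Lemma circle_fst_continuous : continuous (fun z : circle R => (val z).1).
Proof.
move=> z; apply: (@continuous_comp _ _ _ (fun z : circle R => val z) fst).
  exact: circle_val_continuous.
exact: cvg_fst.
Qed.

Lemma circle_snd_continuous : continuous (fun z : circle R => (val z).2).
Proof.
move=> z; apply: (@continuous_comp _ _ _ (fun z : circle R => val z) snd).
  exact: circle_val_continuous.
exact: cvg_snd.
Qed.

Lemma circle_div_continuous (T : topologicalType) (f g : T -> circle R) :
  continuous f -> continuous g ->
  continuous (fun y => circle_div (f y) (g y)).
Proof.
move=> cf cg; apply: continuous_comp_initial => t /=.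
have vf1 : (val (f y)).1 @[y --> t] --> (val (f t)).1.
  apply: (@continuous_comp _ _ _ f (fun z : circle R => (val z).1)).
    exact: cf.
  exact: circle_fst_continuous.
have vf2 : (val (f y)).2 @[y --> t] --> (val (f t)).2.
  apply: (@continuous_comp _ _ _ f (fun z : circle R => (val z).2)).
    exact: cf.
  exact: circle_snd_continuous.
have vg1 : (val (g y)).1 @[y --> t] --> (val (g t)).1.
  apply: (@continuous_comp _ _ _ g (fun z : circle R => (val z).1)).
    exact: cg.
  exact: circle_fst_continuous.
have vg2 : (val (g y)).2 @[y --> t] --> (val (g t)).2.
  apply: (@continuous_comp _ _ _ g (fun z : circle R => (val z).2)).
    exact: cg.
  exact: circle_snd_continuous.
apply: (@cvg_pair _ _ _ _ (nbhs _) (nbhs _) _ _ _ (fun y => _ + _)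
  (fun y => _ - _)).
- by apply: cvgD; apply: cvgM.
- by apply: cvgB; apply: cvgM.
Qed.

(** A branch of the logarithm that inverts [circle_exp] on the open right
    half-circle, which is the only place where it is used. *)
Definition circle_log z : R := asin (val z).2 / (2 * pi).

Lemma circle_logK z : 0 < (val z).1 -> circle_exp (circle_log z) = z.
Proof.
move=> x0; have zE := circleE z.
have y1 : -1 <= (val z).2 <= 1 by apply/andP; split; nra.
have p0 : 2 * pi != 0 :> R by rewrite mulf_neq0 ?pnatr_eq0 ?gt_eqF ?pi_gt0.
apply: circle_eq => /=; rewrite mulrCA divff // mulr1; last exact: asinK.
by rewrite cos_asin // -zE addrK sqrtr_sqr gtr0_norm.
Qed.

Lemma circle_log_continuous z :
  0 < (val z).1 -> {for z, continuous circle_log}.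
Proof.
move=> x0; have zE := circleE z.
have y1 : -1 < (val z).2 < 1 by apply/andP; split; nra.
suff ca : {for z, continuous (fun z : circle R => asin (val z).2)}.
  exact: (cvgM ca (cvg_cst _)).
apply: (@continuous_comp _ _ _ (fun z : circle R => (val z).2) (@asin R)).
  exact: circle_snd_continuous.
exact: continuous_asin.
Qed.

Lemma circle_log1 : circle_log (circle_exp 0) = 0.
Proof.
rewrite /circle_log /= mulr0 sin0 -[X in asin X](@sin0 R) sinK ?mul0r //.
by rewrite in_itv /= oppr_le0 andbb divr_ge0 // pi_ge0.
Qed.

(** [circle_exp] is open: near [circle_exp t] it has the continuous section
    [z |-> t + circle_log (z / circle_exp t)]. *)
Lemma near_circle_exp (P : set (circle R)) t :
  (\forall s \near t, P (circle_exp s)) -> \forall z \near circle_exp t, P z.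
Proof.
move=> Pt; pose z0 := circle_exp t.
pose q z := circle_div z z0.
have cq : continuous q.
  apply: circle_div_continuous => z; first exact: cvg_id.
  exact: (@cst_continuous (circle R) (circle R) z0 z).
have q1 : q z0 = circle_exp 0 by exact: circle_divzz.
have posq : \forall z \near z0, 0 < (val (q z)).1.
  have : {for z0, continuous (fun z => (val (q z)).1)}.
    apply: (@continuous_comp _ _ _ q (fun z : circle R => (val z).1)).
      exact: cq.
    exact: circle_fst_continuous.
  move=> c1; apply: (cvgr_gt _ c1).
  by rewrite q1 /= mulr0 cos0.
have cs : t + circle_log (q z) @[z --> z0] --> t.
  rewrite -[X in _ --> X]addr0; apply: (@cvgD _ _ _ _ (nbhs_filter z0) (fun=> t)
    (fun z => circle_log (q z))).
    exact: (@cst_continuous (circle R) R t z0).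
  rewrite -circle_log1 -q1.
  apply: (@continuous_comp _ _ _ q circle_log); first exact: cq.
  by apply: circle_log_continuous; rewrite q1 /= mulr0 cos0.
near=> z.
have -> : z = circle_exp (t + circle_log (q z)).
  apply: (@circle_exp_div z0); last by [].
  by rewrite circle_logK //; near: z.
near: z; exact: (cs _ Pt).
Unshelve. all: by end_near. Qed.

(** The circle carries the quotient topology of the line, so a map out of it
    can be shown to be continuous upstairs. *)
Lemma continuous_from_circle (T : topologicalType) (f : circle R -> T) :
  continuous (f \o @circle_exp R) -> continuous f.
Proof.
move=> cf z; have [t <-] := circle_exp_surj z => B fB.
exact/near_circle_exp/(cf t B fB).
Qed.

End CircleExp.

(** * Lifting maps of the square *)

Section Lifting.
Context {R : realType}.
Implicit Types (s t u v : R).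

(** The retraction of the line onto [0, 1].  Composing with it turns a map that
    is continuous within [0, 1] into one that is continuous everywhere, so that
    all lifts below can be taken continuous on the whole line or plane. *)
Definition clamp t : R := Num.min (Num.max t 0) 1.

Lemma clamp_itv t : clamp t \in `[0, 1].
Proof.
rewrite in_itv /= /clamp le_min ler01 le_max lexx orbT /=.
by rewrite ge_min lexx orbT.
Qed.

Lemma clamp_id t : t \in `[0, 1] -> clamp t = t.
Proof.
rewrite in_itv /= => /andP[t0 t1].
by rewrite /clamp (max_idPl t0) (min_idPl t1).
Qed.

Lemma clamp_continuous : continuous clamp.
Proof.
move=> t; apply: (@continuous_min _ _ (fun t : R => Num.max t 0) (fun=> 1)).
  apply: (@continuous_max _ _ (fun t : R => t) (fun=> 0)).
    exact: cvg_id.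
  exact: cvg_cst.
exact: cvg_cst.
Qed.

Lemma within_retract (S T U : topologicalType) (A : set T) (r : S -> T)
    (f : T -> U) :
  continuous r -> (forall x, A (r x)) -> {within A, continuous f} ->
  continuous (f \o r).
Proof.
move=> cr rA cf x B /(cf (r x)).
rewrite /nbhs /= -nbhs_subspace_in; last exact: rA.
rewrite /within /= => /(cr x); rewrite /nbhs /=.
by apply: filterS => y /= /(_ (rA y)).
Qed.

Definition clamp2 (p : R * R) : R * R := (clamp p.1, clamp p.2).

Lemma clamp2_continuous : continuous clamp2.
Proof.
move=> p; apply: (@cvg_pair _ _ _ _ (nbhs _) (nbhs _) _ _ _
  (fun p => clamp p.1) (fun p => clamp p.2)).
- apply: (@continuous_comp _ _ _ fst clamp); last exact: clamp_continuous.
  exact: cvg_fst.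
- apply: (@continuous_comp _ _ _ snd clamp); last exact: clamp_continuous.
  exact: cvg_snd.
Qed.

Local Notation K := (`[0, 1]%classic `*` `[0, 1]%classic : set (R * R)).

(** Uniform continuity on the square, in the form needed for lifting: values at
    close points differ by a rotation in the domain of [circle_log]. *)
Lemma uniformly_close (h : R * R -> circle R) : continuous h ->
  exists n : nat, forall p q, K p -> ball p n.+1%:R^-1 q ->
    0 < (val (circle_div (h q) (h p))).1.
Proof.
move=> ch.
have : compact K by apply: compact_setX; exact: segment_compact.
move/compact_near_coveringP => /(_ nat \oo
  (fun n p => forall q, ball p n.+1%:R^-1 q ->
    0 < (val (circle_div (h q) (h p))).1)) [x _ |n _ /(_ n (leqnn n)) Hn];
  last by exists n => p q Kp; exact: Hn.
pose D (pq : (R * R) * (R * R)) := circle_div (h pq.2) (h pq.1).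
have cD : continuous D.
  apply: circle_div_continuous => pq.
    by apply: (@continuous_comp _ _ _ snd h); [exact: cvg_snd | exact: ch].
  by apply: (@continuous_comp _ _ _ fst h); [exact: cvg_fst | exact: ch].
have cD1 : {for (x, x), continuous (fun pq => (val (D pq)).1)}.
  apply: (@continuous_comp _ _ _ D (fun z : circle R => (val z).1)).
    exact: cD.
  exact: circle_fst_continuous.
have : 0 < (val (D (x, x))).1 by rewrite /D circle_divzz /= mulr0 cos0.
move/(cvgr_gt _ cD1) => /nbhs_ballP[e /= e0 He].
have e20 : 0 < e / 2 by rewrite divr_gt0.
near=> y n.
have ne : n.+1%:R^-1 < e / 2.
  by near: n; exact: (near_infty_natSinv_lt (PosNum e20)).
move=> q yq.
have xy : ball x (e / 2) y by near: y; exact: nbhsx_ballx.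
apply: (He (y, q)); split => /=.
  by apply: le_ball xy; lra.
rewrite [e]splitr; apply: (ball_triangle xy); apply: le_ball yq.
exact: ltW.
Unshelve. all: by end_near. Qed.

(** Let [pt i p] be the point at fraction [i / N] of the segment from the origin
    to [p].  When [N] is large, consecutive quotients
    [h (pt i.+1 p) / h (pt i p)] stay in the right half-circle, uniformly in
    [p]; since [h (pt N p)] is [h (0, 0)] times the product of these quotients,
    adding up their logarithms gives a lift, and it is continuous in [p] because
    every summand is.  Paths are the case of a map of the second coordinate. *)
Lemma square_lift (H : R * R -> circle R) : {within K, continuous H} ->
  exists2 L : R * R -> R, continuous L &
    forall s t, s \in `[0, 1] -> t \in `[0, 1] ->
      circle_exp (L (s, t)) = H (s, t).
Proof.
move=> cH.
have clampK p : K (clamp2 p) by split; exact: clamp_itv.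
pose h := H \o clamp2.
have ch : continuous h.
  by apply: within_retract cH => //; exact: clamp2_continuous.
have [n close] := uniformly_close ch.
(* One step more than the radius asks for, as balls are open and the largest
   step has length exactly 1 / N. *)
pose N : R := n.+2%:R.
have N0 : 0 < N by rewrite ltr0n.
pose pt (i : nat) (p : R * R) : R * R := (i%:R / N * p.1, i%:R / N * p.2).
have ptc i : continuous (pt i).
  move=> p; apply: (@cvg_pair _ _ _ _ (nbhs _) (nbhs _) _ _ _
    (fun p => _ * p.1) (fun p => _ * p.2)).
  - by apply: cvgMr; exact: cvg_fst.
  - by apply: cvgMr; exact: cvg_snd.
pose q (i : nat) p := circle_div (h (pt i.+1 p)) (h (pt i p)).
have qc i : continuous (q i).
  by apply: circle_div_continuous => p;
    apply: continuous_comp; [exact: ptc| exact: ch|exact: ptc| exact: ch].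
have q0 i p : (i < n.+2)%N -> K p -> 0 < (val (q i p)).1.
  case: p => s t iN [/=]; rewrite !in_itv /= => /andP[s0 s1] /andP[t0 t1].
  have iN1 : i%:R / N <= 1 by rewrite ler_pdivrMr // mul1r ler_nat ltnW.
  have i0 : 0 <= i%:R / N by rewrite divr_ge0 // ltW.
  apply: close.
    have inI (r : R) : 0 <= r <= 1 -> 0 <= i%:R / N * r <= 1.
      move: (i%:R / N) i0 iN1 => a a0 a1 /andP[r0 r1].
      by apply/andP; split; nra.
    by split; rewrite /= in_itv /= inI // ?s0 ?t0.
  have SN : i.+1%:R / N = i%:R / N + N^-1 by rewrite -natr1 mulrDl mul1r.
  have Nn : N^-1 < n.+1%:R^-1.
    by rewrite ltf_pV2 ?posrE ?ltr0n // ltr_nat.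
  have Ni : 0 < N^-1 by rewrite invr_gt0.
  have step (r : R) : 0 <= r <= 1 ->
      `|i%:R / N * r - i.+1%:R / N * r| < n.+1%:R^-1.
    move=> /andP[r0 r1].
    rewrite SN (_ : _ - _ = - (N^-1 * r)); last first.
      by rewrite mulrDl opprD addrA subrr add0r.
    have Nr : 0 <= N^-1 * r by rewrite mulr_ge0 // ltW.
    by rewrite normrN ger0_norm // (le_lt_trans _ Nn) // ler_piMr // ltW.
  by split; rewrite /ball /= step // ?s0 ?t0.
have [u0 u0E] := circle_exp_surj (h (0, 0)).
pose L j p := u0 + \sum_(i < j) circle_log (q i p).
have Lexp j p : (j <= n.+2)%N -> K p -> circle_exp (L j p) = h (pt j p).
  move=> + Kp; elim: j => [|j IH] jN.
    by rewrite /L big_ord0 addr0 u0E /pt !mul0r.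
  apply/esym; rewrite /L big_ord_recr /= addrA.
  apply: circle_exp_div (esym (IH (ltnW jN))).
  by rewrite circle_logK //; exact: q0.
have Lc j p : (j <= n.+2)%N -> K p -> {for p, continuous (L j)}.
  move=> + Kp; elim: j => [|j IH] jN.
    rewrite (_ : L 0%N = fun=> u0); first exact: cvg_cst.
    by apply/funext => x; rewrite /L big_ord0 addr0.
  rewrite (_ : L j.+1 = fun p => L j p + circle_log (q j p)); last first.
    by apply/funext => x; rewrite /L big_ord_recr /= addrA.
  apply: (@cvgD _ _ _ _ _ (L j) (fun p => circle_log (q j p))).
    exact/IH/ltnW.
  apply: (@continuous_comp _ _ _ (q j) circle_log); first exact: qc.
  by apply: circle_log_continuous; exact: q0.
exists (L n.+2 \o clamp2).
  move=> p; apply: continuous_comp; first exact: clamp2_continuous.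
  exact: Lc.
move=> s t s01 t01 /=; rewrite Lexp // /h /pt /= !divff ?gt_eqF // !mul1r.
by rewrite /clamp2 /= !clamp_id.
Qed.

End Lifting.

(** * Lifted paths and the homotopy criterion *)

Section LiftedPaths.
Context {R : realType}.
Implicit Types (s t u v w : R) (c d : R -> circle R).

(** Two different integer values would, by the intermediate value theorem, be
    accompanied by a half-integer one. *)
Lemma int_valued_const (f : R -> R) s t : continuous f -> s <= t ->
  (forall x, x \in `[s, t] -> f x \is a Num.int) -> f s = f t.
Proof.
move=> cf st fint.
have is_ : f s \is a Num.int by apply: fint; rewrite in_itv /= lexx st.
have it : f t \is a Num.int by apply: fint; rewrite in_itv /= lexx st.
wlog lt : f cf fint is_ it / f s <= f t.
  move=> wl; have [le|/ltW le] := leP (f s) (f t); first exact: wl.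
  apply: oppr_inj; apply: (wl (fun x => - f x)) => //.
  - by move=> x; apply: cvgN; exact: cf.
  - by move=> x xst; rewrite rpredN fint.
  - by rewrite rpredN.
  - by rewrite rpredN.
  - by rewrite lerN2.
apply/eqP; rewrite eq_le lt /= leNgt; apply/negP => fst.
have [a fa] := intrP is_; have [b fb] := intrP it.
have ab : (a < b)%R by rewrite -(ltr_int R) -fa -fb.
have ab1 : a%:~R + 1 <= b%:~R :> R by rewrite -intrD1 ler_int lezD1.
have cst : {within `[s, t], continuous f} by apply: continuous_subspaceT.
have [|x xst fx] := @IVT R f s t (a%:~R + 2^-1) st cst.
  by rewrite (min_idPl lt) (max_idPr lt) fa fb; apply/andP; split; lra.
have [m fm] := intrP (fint x xst).
have m1 : a%:~R < m%:~R :> R by lra.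
have m2 : m%:~R < (a + 1)%:~R :> R by rewrite intrD1; lra.
by move: m1 m2; rewrite !ltr_int; lia.
Qed.

(** Only the endpoints of the lift are recorded: they determine the homotopy
    class of [c] (see [path_homotopicP]), and they can be computed for iterates,
    reverses and concatenations without manipulating the lift itself. *)
Definition has_lift c u v := exists C : R -> R,
  [/\ continuous C, C 0 = u, C 1 = v &
      forall t, t \in `[0, 1] -> c t = circle_exp (C t)].

Let i0 : (0 : R) \in `[0, 1]. Proof. by rewrite in_itv /= lexx ler01. Qed.
Let i1 : (1 : R) \in `[0, 1]. Proof. by rewrite in_itv /= lexx ler01. Qed.

Lemma circle_exp_int s t : circle_exp s = circle_exp t -> s - t \is a Num.int.
Proof.
by move/circle_exp_eq => [k ->]; rewrite addrAC subrr add0r intr_int.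
Qed.

Lemma lifts_differ_const (C D : R -> R) : continuous C -> continuous D ->
  (forall t, t \in `[0, 1] -> circle_exp (C t) = circle_exp (D t)) ->
  C 1 - D 1 = C 0 - D 0.
Proof.
move=> cC cD CD; apply/esym.
apply: (@int_valued_const (fun t => C t - D t)) ler01 _ => t.
  by apply: cvgB; [exact: cC | exact: cD].
by move=> /CD /circle_exp_int.
Qed.

Lemma has_lift_path c u v : has_lift c u v ->
  is_path (circle_exp u) (circle_exp v) c.
Proof.
move=> [C [cC <- <- cE]]; split; [|exact: cE..].
have : {within `[0, 1], continuous (@circle_exp R \o C)}.
  apply: continuous_subspaceT => t; apply: continuous_comp; first exact: cC.
  exact: circle_exp_continuous.
by apply: subspace_eq_continuous => t /set_mem /cE.
Qed.

Lemma path_has_lift x y c u : is_path x y c -> circle_exp u = x ->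
  exists v, has_lift c u v.
Proof.
move=> [cc c0 c1] ux.
have ccl : continuous (c \o clamp).
  apply: within_retract cc => [|t]; first exact: clamp_continuous.
  exact: clamp_itv.
have [|L cL LE] := @square_lift R ((c \o clamp) \o snd).
  apply: continuous_subspaceT => p; apply: continuous_comp; last exact: ccl.
  exact: cvg_snd.
have [k uk] : exists k : int, u = L (0, 0) + k%:~R.
  by apply/circle_exp_eq; rewrite ux LE //= clamp_id.
exists (L (0, 1) + k%:~R), (fun t => L (0, t) + k%:~R); split => // [t|t t01].
  apply: (@cvgD _ _ _ _ _ (fun t => L (0, t)) (fun=> k%:~R));
    last exact: cvg_cst.
  apply: (@continuous_comp _ _ _ (fun t => (0, t)) L); last exact: cL.
  apply: (@cvg_pair _ _ _ _ (nbhs _) (nbhs _) _ _ _ (fun=> 0) id).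
    exact: cvg_cst.
  exact: cvg_id.
by rewrite circle_expD_int LE //= clamp_id.
Qed.

Lemma has_lift_shift c u v (k : int) :
  has_lift c u v -> has_lift c (u + k%:~R) (v + k%:~R).
Proof.
move=> [C [cC <- <- cE]]; exists (fun t => C t + k%:~R); split => // [t|t t01].
  by apply: (@cvgD _ _ _ _ _ C (fun=> _)); [exact: cC | exact: cvg_cst].
by rewrite circle_expD_int cE.
Qed.

Lemma has_lift_rev c u v : has_lift c u v -> has_lift (path_rev c) v u.
Proof.
move=> [C [cC <- <- cE]]; exists (fun t => C (1 - t)); split.
- move=> t; apply: (@continuous_comp _ _ _ (fun t => 1 - t) C); last exact: cC.
  by apply: cvgB; [exact: cvg_cst | exact: cvg_id].
- by rewrite subr0.
- by rewrite subrr.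
- move=> t; rewrite in_itv /= => /andP[t0 t1]; apply: cE.
  by rewrite in_itv /=; apply/andP; split; lra.
Qed.

(** [C] is frozen at its endpoint while [D] runs and conversely, so the lift of
    the concatenation is a sum of clamped lifts and continuity needs no case
    distinction. *)
Lemma has_lift_cat c d u v w :
  has_lift c u v -> has_lift d v w -> has_lift (path_cat c d) u w.
Proof.
move=> [C [cC C0 C1 CE]] [D [cD D0 D1 DE]].
exists (fun t => C (clamp (2 * t)) + D (clamp (2 * t - 1)) - v).
have c2 : continuous (fun t : R => 2 * t) by move=> t; exact: mulrl_continuous.
have c21 : continuous (fun t : R => 2 * t - 1).
  by move=> t; apply: cvgB; [exact: c2 | exact: cvg_cst].
have clamp_lo t : t <= 0 -> clamp t = 0 :> R.
  by move=> t0; rewrite /clamp (max_idPr t0) (min_idPl _).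
have clamp_hi t : 1 <= t -> clamp t = 1 :> R.
  by move=> t1; rewrite /clamp (min_idPr _) // le_max t1.
split.
- move=> t; apply: (@cvgB _ _ _ _ _ (fun t => C (clamp (2 * t)) +
    D (clamp (2 * t - 1))) (fun=> v)); last exact: cvg_cst.
  apply: (@cvgD _ _ _ _ _ (fun t => C (clamp (2 * t)))
    (fun t => D (clamp (2 * t - 1)))).
    apply: (@continuous_comp _ _ _ (fun t => clamp (2 * t)) C); last exact: cC.
    apply: (@continuous_comp _ _ _ (fun t => 2 * t) clamp); first exact: c2.
    exact: clamp_continuous.
  apply: (@continuous_comp _ _ _ (fun t => clamp (2 * t - 1)) D);
    last exact: cD.
  apply: (@continuous_comp _ _ _ (fun t => 2 * t - 1) clamp); first exact: c21.
  exact: clamp_continuous.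
- rewrite (clamp_lo (2 * 0)) ?(clamp_lo (2 * 0 - 1)); [|lra..].
  by rewrite C0 D0 addrK.
- rewrite (_ : 2 * 1 - 1 = 1); last by ring.
  rewrite mulr1 (clamp_hi 2) ?(clamp_hi 1) ?ler1n //.
  by rewrite C1 D1 addrAC subrr add0r.
- move=> t; rewrite in_itv /= => /andP[t0 t1]; rewrite /path_cat.
  case: ifPn => [th|/negbTE/negbT]; last rewrite -ltNge => th.
    have i : 2 * t \in `[0, 1] by rewrite in_itv /=; apply/andP; split; lra.
    by rewrite (clamp_id i) clamp_lo ?D0 ?addrK ?CE //; lra.
  have i : 2 * t - 1 \in `[0, 1] by rewrite in_itv /=; apply/andP; split; lra.
  rewrite (clamp_id i) clamp_hi; last lra.
  by rewrite C1 addrAC subrr add0r DE.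
Qed.

Lemma has_lift_map (f : circle R -> circle R) (F : R -> R) c u v :
  continuous F -> (forall t, f (circle_exp t) = circle_exp (F t)) ->
  has_lift c u v -> has_lift (f \o c) (F u) (F v).
Proof.
move=> cF fF [C [cC <- <- cE]]; exists (F \o C); split => // [t|t t01].
  by apply: continuous_comp; [exact: cC | exact: cF].
by rewrite /= cE.
Qed.

Lemma has_lift_cst u : has_lift (cst (circle_exp u)) u u.
Proof. by exists (fun=> u); split => // t; exact: cvg_cst. Qed.

Lemma has_lift_exists u v : exists c, has_lift c u v.
Proof.
exists (fun t => circle_exp (u + (v - u) * t)), (fun t => u + (v - u) * t).
split => //; [|by rewrite mulr0 addr0|by rewrite mulr1 addrC subrK].
move=> t; apply: cvgD; first exact: cvg_cst.
exact: mulrl_continuous.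
Qed.

(** A homotopy with fixed endpoints lifts to the square; the lift is constant on
    the two sides where the homotopy is, so both paths lift to paths with a
    common start and a common end.  Conversely, lifts with the same endpoints
    are joined by the straight-line homotopy. *)
Lemma path_homotopicP c d u v w : has_lift c u v -> has_lift d u w ->
  path_homotopic c d <-> v = w.
Proof.
move=> [C [cC C0 C1 CE]] [D [cD D0 D1 DE]]; split.
  move=> [H [cH Hcd Hends]].
  have [L cL LE] := square_lift cH.
  have cL1 s : continuous (fun t => L (s, t)).
    move=> t; apply: (@continuous_comp _ _ _ (fun t => (s, t)) L);
      last exact: cL.
    apply: (@cvg_pair _ _ _ _ (nbhs _) (nbhs _) _ _ _ (fun=> s) id).
      exact: cvg_cst.
    exact: cvg_id.
  have cL2 t : continuous (fun s => L (s, t)).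
    move=> s; apply: (@continuous_comp _ _ _ (fun s => (s, t)) L);
      last exact: cL.
    apply: (@cvg_pair _ _ _ _ (nbhs _) (nbhs _) _ _ _ id (fun=> t)).
      exact: cvg_id.
    exact: cvg_cst.
  have e0 := @lifts_differ_const _ _ (cL1 0) cC (fun t t01 =>
    etrans (LE 0 t i0 t01) (etrans (Hcd t t01).1 (CE t t01))).
  have e1 := @lifts_differ_const _ _ (cL1 1) cD (fun t t01 =>
    etrans (LE 1 t i1 t01) (etrans (Hcd t t01).2 (DE t t01))).
  have e2 := @lifts_differ_const _ (fun=> u) (cL2 0) (@cst_continuous _ _ _)
    (fun s s01 => etrans (LE s 0 s01 i0) (etrans (Hends s s01).1
      (etrans (CE 0 i0) (congr1 (@circle_exp R) C0)))).
  have e3 := @lifts_differ_const _ (fun=> v) (cL2 1) (@cst_continuous _ _ _)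
    (fun s s01 => etrans (LE s 1 s01 i1) (etrans (Hends s s01).2
      (etrans (CE 1 i1) (congr1 (@circle_exp R) C1)))).
  by move: e0 e1 e2 e3; rewrite C0 C1 D0 D1 /=; lra.
move=> vw.
pose M (p : R * R) := (1 - p.1) * C p.2 + p.1 * D p.2.
have cM : continuous M.
  move=> p; apply: (@cvgD _ _ _ _ _ (fun p => (1 - p.1) * C p.2)
    (fun p => p.1 * D p.2)).
    apply: (@cvgM _ _ _ _ (fun p : R * R => 1 - p.1) (fun p => C p.2)).
      by apply: cvgB; [exact: cvg_cst | exact: cvg_fst].
    by apply: (@continuous_comp _ _ _ snd C); [exact: cvg_snd | exact: cC].
  apply: (@cvgM _ _ _ _ fst (fun p => D p.2)); first exact: cvg_fst.
  by apply: (@continuous_comp _ _ _ snd D); [exact: cvg_snd | exact: cD].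
exists (@circle_exp R \o M); split => [|t t01|s s01].
- apply: continuous_subspaceT => p; apply: continuous_comp; first exact: cM.
  exact: circle_exp_continuous.
- rewrite /M /= CE // DE // !(subr0, subrr, mul0r, mul1r, addr0, add0r).
  by split.
- rewrite /M /= !CE // C0 D0 C1 D1 vw.
  by split; congr circle_exp; ring.
Qed.

End LiftedPaths.

(** * The degree of a map that crosses 1 in a prescribed way *)

Section CoincidenceIndex.
Context {R : realType}.
Implicit Types (s t : R) (f g : circle R -> circle R).

Lemma circle_exp_eq1 t : circle_exp t = circle_exp 0 <-> t \is a Num.int.
Proof.
split=> [/circle_exp_int|/intrP[k ->]]; first by rewrite subr0.
by rewrite -[k%:~R]add0r circle_expD_int.
Qed.

Lemma near_floor (F : R -> R) t : {for t, continuous F} ->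
  F t \isn't a Num.int -> \forall s \near t, Num.floor (F s) = Num.floor (F t).
Proof.
move=> cF Fi; set m := Num.floor (F t).
have mF : m%:~R < F t.
  rewrite lt_neqAle floor_le_tmp andbT; apply: contraNneq Fi => <-.
  exact: intr_int.
have Fm : F t < (m + 1)%:~R by exact: floorD1_gt.
near=> s; apply: floor_def; apply/andP; split.
  by apply/ltW; near: s; exact: (cvgr_gt _ cF).
by near: s; exact: (cvgr_lt _ cF).
Unshelve. all: by end_near. Qed.

Lemma near_floor_int (F : R -> R) t (m : int) : {for t, continuous F} ->
  F t = m%:~R ->
  \forall s \near t, Num.floor (F s) = if F t <= F s then m else m - 1.
Proof.
move=> cF Fm; near=> s.
have lo : (m - 1)%:~R < F s.
  by near: s; apply: (cvgr_gt _ cF); rewrite Fm ltr_int; lia.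
have hi : F s < (m + 1)%:~R.
  by near: s; apply: (cvgr_lt _ cF); rewrite Fm ltr_int; lia.
case: ifPn => [|/negbTE/negbT]; rewrite Fm.
  by move=> le; apply: floor_def; rewrite le.
by rewrite -ltNge => lt; apply: floor_def; rewrite (ltW lo) subrK.
Unshelve. all: by end_near. Qed.

(** Two functions that are integral at the same points and pass through these
    integers in the same direction have floors that jump together: the
    difference of the floors is locally constant, hence constant.  This computes
    degrees without knowing that the integral points are isolated, which fails
    for general maps of the circle. *)
Lemma floor_diff_const (F G : R -> R) : continuous F -> continuous G ->
  (forall t, (F t \is a Num.int) = (G t \is a Num.int)) ->
  (forall t, F t \is a Num.int ->
    \forall s \near t, (F t <= F s) = (G t <= G s)) ->
  Num.floor (F 1) - Num.floor (F 0) = Num.floor (G 1) - Num.floor (G 0).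
Proof.
move=> cF cG FGi FGs.
pose D t : R := (Num.floor (F t) - Num.floor (G t))%:~R.
have cD : continuous D.
  move=> t; apply: near_cst_continuous; rewrite /D.
  have [Fi|Fi] := boolP (F t \is a Num.int); last first.
    have Gi : G t \isn't a Num.int by rewrite -FGi.
    have nF := near_floor (cF t) Fi; have nG := near_floor (cG t) Gi.
    by near=> s; rewrite (near nF s) // (near nG s).
  have /intrP[m Fm] := Fi.
  have /intrP[n Gn] : G t \is a Num.int by rewrite -FGi.
  have nF := near_floor_int (cF t) Fm; have nG := near_floor_int (cG t) Gn.
  have nFG := FGs t Fi.
  near=> s; rewrite (near nF s) // (near nG s) // (near nFG s) //.
  rewrite Fm Gn !intrKfloor; congr (_%:~R).
  by case: ifP => _ //; lia.
have /eqP : D 0 = D 1.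
  by apply: int_valued_const => // t _; exact: intr_int.
rewrite eqr_int => /eqP.
by move: (Num.floor (F 0)) (Num.floor (F 1)) (Num.floor (G 0))
  (Num.floor (G 1)) => a b c d; lia.
Unshelve. all: by end_near. Qed.

Lemma lift_addz (F : R -> R) (a : int) : (forall t, F (t + 1) = F t + a%:~R) ->
  forall t (k : int), F (t + k%:~R) = F t + (a * k)%:~R.
Proof.
move=> Fa; have Fn t (n : nat) : F (t + n%:R) = F t + (a * n)%:~R.
  elim: n => [|n IH]; first by rewrite mulr0 !addr0.
  rewrite -natr1 addrA Fa IH -addrA -intrD; congr (_ + _%:~R); lia.
move=> t [n|n]; first exact: Fn.
rewrite NegzE -[in RHS](subrK (n.+1%:R) t) Fn -addrA -intrD.
by rewrite mulrN addrN addr0 mulrNz.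
Qed.

(** The converse of lifting: a function on the line that commutes with integer
    translations up to a degree descends to the circle. *)
Lemma circle_map_of_lift (F : R -> R) (a : int) : continuous F ->
  (forall t, F (t + 1) = F t + a%:~R) ->
  exists f, [/\ continuous f, has_degree f a &
                forall t, f (circle_exp t) = circle_exp (F t)].
Proof.
move=> cF Fa; pose lift z : R := projT1 (cid (circle_exp_surj z)).
have liftE z : circle_exp (lift z) = z by rewrite /lift; case: cid.
pose f z := circle_exp (F (lift z)).
have fE t : f (circle_exp t) = circle_exp (F t).
  have /circle_exp_eq[k kE] := liftE (circle_exp t).
  by rewrite /f kE (lift_addz Fa) circle_expD_int.
exists f; split => //; last by exists F.
apply: continuous_from_circle.
have -> : f \o @circle_exp R = @circle_exp R \o F.
  by apply/funext => t; exact: fE.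
by move=> t; apply: continuous_comp; [exact: cF | exact: circle_exp_continuous].
Qed.

End CoincidenceIndex.

Section Staircase.
Context {R : realType}.
Implicit Types (s t x : R).

(** The staircase [W] is flattened between integers but has slope [M] near each
    of them.  It turns [s], which is integral exactly at the wanted points, into
    a function with the same integral points that agrees with [M * s] up to an
    integer near them; if [M > 1] the function [M * s] itself would be integral
    too often. *)
Lemma exists_staircase (M : R) : 1 <= M -> exists W : R -> R,
  [/\ continuous W, forall s, W (s + 1) = W s + 1,
      forall s, (W s \is a Num.int) = (s \is a Num.int) &
      forall (j : int) s, `|s - j%:~R| < (2 * M)^-1 ->
        W s = M * (s - j%:~R) + j%:~R].
Proof.
move=> M1; have M0 : 0 < M by exact: lt_le_trans M1.
(* One step on [0, 1]: slope [M] at both ends, the plateau 1 / 2 between. *)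
pose w x := Num.min (M * x) (Num.max 2^-1 (M * x - M + 1)).
have cM : continuous (fun x => M * x) by move=> x; exact: mulrl_continuous.
have cw : continuous w.
  move=> x; apply: (@continuous_min _ _ (fun x => M * x)
    (fun x => Num.max 2^-1 (M * x - M + 1))); first exact: cM.
  apply: (@continuous_max _ _ (fun=> 2^-1) (fun x => M * x - M + 1)).
    exact: cvg_cst.
  apply: (@cvgD _ _ _ _ _ (fun x => M * x - M) (fun=> 1)); last exact: cvg_cst.
  by apply: (@cvgB _ _ _ _ _ (fun x => M * x) (fun=> M));
    [exact: cM | exact: cvg_cst].
have w0 : w 0 = 0.
  rewrite /w mulr0 (min_idPl _) // le_max; apply/orP; left.
  by rewrite invr_ge0.
have w1 : w 1 = 1.
  rewrite /w mulr1 subrr add0r (max_idPr _) ?(min_idPr _) //.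
  by rewrite invf_le1 // ler1n.
have w01 x : 0 < x < 1 -> 0 < w x < 1.
  move=> /andP[x0 x1]; rewrite /w lt_min lt_max gt_min gt_max.
  by apply/andP; split; [apply/andP; split; [nra|apply/orP; left; lra]|
    apply/orP; right; apply/andP; split; nra].
pose W s := (Num.floor s)%:~R + w (s - (Num.floor s)%:~R).
have floorD1 s : Num.floor (s + 1) = Num.floor s + 1.
  by rewrite floorDrz ?intr_int // -[1]/(1%:~R) intrKfloor.
have WD s : W (s + 1) = W s + 1.
  by rewrite /W floorD1 intrD1 addrAC; congr (_ + w _ + _); lra.
have frac s : 0 <= s - (Num.floor s)%:~R < 1.
  rewrite subr_ge0 floor_le_tmp /= ltrBlDl -intrD1; exact: floorD1_gt.
exists W; split=> //.
- move=> s0; pose j : R := (Num.floor s0)%:~R.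
  have /andP[lo hi] := frac s0.
  (* Around [s0] the floor takes at most the values [j] and [j - 1]; [V] treats
     both sides of [j] at once by a continuous formula. *)
  pose V s := j + w (Num.max (s - j) 0) + (w (Num.min (s - j) 0 + 1) - 1).
  have VW : \forall s \near s0, V s = W s.
    near=> s.
    have sl : j - 1 < s.
      by near: s; apply: (cvgr_gt s0); [exact: cvg_id | rewrite /j; lra].
    have sh : s < j + 1.
      by near: s; apply: (cvgr_lt s0); [exact: cvg_id | rewrite /j; lra].
    rewrite /V; have [js|sj] := leP j s.
      have fs : Num.floor s = Num.floor s0.
        by apply: floor_def; rewrite intrD1 js.
      rewrite (max_idPl _) ?subr_ge0 // (min_idPr _) ?subr_ge0 //.
      by rewrite add0r w1 subrr addr0 /W fs.
    have fs : Num.floor s = Num.floor s0 - 1.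
      apply: floor_def; rewrite subrK intrB; apply/andP; split=> //; exact: ltW.
    have sj0 : s - j <= 0 by lra.
    rewrite (max_idPr sj0) (min_idPl sj0) w0 addr0 /W fs intrB -/j.
    by rewrite (_ : s - (j - 1) = s - j + 1); ring.
  have cV : {for s0, continuous V}.
    have cj : {for s0, continuous (fun s => s - j)}.
      by apply: cvgB; [exact: cvg_id | exact: cvg_cst].
    apply: (@cvgD _ _ _ _ _ (fun s => j + w (Num.max (s - j) 0))
      (fun s => w (Num.min (s - j) 0 + 1) - 1)).
      apply: (@cvgD _ _ _ _ _ (fun=> j)); first exact: cvg_cst.
      apply: (@continuous_comp _ _ _ (fun s => Num.max (s - j) 0) w);
        last exact: cw.
      by apply: (@continuous_max _ _ (fun s => s - j) (fun=> 0));
        [exact: cj | exact: cvg_cst].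
    apply: (@cvgD _ _ _ _ _ (fun s => w (Num.min (s - j) 0 + 1))
      (fun=> -1)); last exact: cvg_cst.
    apply: (@continuous_comp _ _ _ (fun s => Num.min (s - j) 0 + 1) w);
      last exact: cw.
    apply: (@cvgD _ _ _ _ _ (fun s => Num.min (s - j) 0) (fun=> 1));
      last exact: cvg_cst.
    by apply: (@continuous_min _ _ (fun s => s - j) (fun=> 0));
      [exact: cj | exact: cvg_cst].
  rewrite /continuous_at -(nbhs_singleton VW).
  exact: cvg_trans (near_eq_cvg VW) cV.
- move=> s; have /andP[lo hi] := frac s.
  apply/idP/idP => [|/intrP[k ->]]; last first.
    by rewrite /W intrKfloor subrr w0 addr0 intr_int.
  rewrite /W rpredDl ?intr_int // => wi.
  have [s0|s0] := eqVneq (s - (Num.floor s)%:~R) 0.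
    by rewrite -[s](subrK (Num.floor s)%:~R) s0 add0r intr_int.
  have /w01/andP[wlo whi] : 0 < s - (Num.floor s)%:~R < 1.
    by rewrite hi andbT lt_neqAle eq_sym s0.
  have /intrP[k kE] := wi.
  by move: wlo whi; rewrite kE ltr0z ltrz1; lia.
- move=> j s; rewrite ltr_norml => /andP[lo hi].
  have M2 : 0 < (2 * M)^-1 by rewrite invr_gt0 mulr_gt0.
  have M21 : (2 * M)^-1 * M = 2^-1.
    by rewrite invfM -mulrA mulVf ?mulr1 ?gt_eqF.
  have M2h : (2 * M)^-1 <= 2^-1 by nra.
  have [js|sj] := leP j%:~R s.
    have fs : Num.floor s = j by apply: floor_def; rewrite js intrD1; lra.
    rewrite /W fs addrC; congr (_ + _); apply: min_idPl.
    rewrite le_max; apply/orP; left; nra.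
  have fs : Num.floor s = j - 1.
    by apply: floor_def; rewrite subrK sj andbT intrB; lra.
  have -> : W s = (j - 1)%:~R + w (s - (j - 1)%:~R) by rewrite /W fs.
  rewrite intrB opprB; set x := s + (1 - j%:~R).
  have -> : w x = M * x - M + 1.
    rewrite /w (max_idPr _); first apply: min_idPr; rewrite /x; nra.
  by rewrite /x; ring.
Unshelve. all: by end_near. Qed.

End Staircase.

(** * The coincidence index of a Nielsen class *)

Section IndexOfFiber.
Context {R : realType}.
Variables (f g : circle R -> circle R) (F G : R -> R) (N r : int).
Hypotheses (cF : continuous F) (cG : continuous G).
Hypotheses (fF : forall t, f (circle_exp t) = circle_exp (F t))
           (gG : forall t, g (circle_exp t) = circle_exp (G t)).
Implicit Types (s t : R).

Let H t := G t - F t.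
Hypothesis HN : forall t, H (t + 1) = H t + N%:~R.

(** Nielsen classes turn out to have this form, [h] being the difference of the
    lifts of the two maps. *)
Definition fiber (h : R -> R) (m : int) : set (circle R) :=
  [set circle_exp t | t in [set t | h t = m%:~R]].

Let cH : continuous H.
Proof. by move=> t; apply: cvgB; [exact: cG | exact: cF]. Qed.

Lemma fiberP t : fiber H r (circle_exp t) <->
  exists k : int, H t = (r + N * k)%:~R.
Proof.
split=> [[s /= Hs /circle_exp_eq[k stk]]|[k Hk]].
  exists (- k); have -> : t = s + (- k)%:~R by rewrite stk mulrNz addrK.
  by rewrite (lift_addz HN) Hs -intrD.
exists (t + (- k)%:~R); last exact: circle_expD_int.
by rewrite /= (lift_addz HN) Hk -intrD; congr _%:~R; lia.
Qed.

(** Any map [psi] that may be used to compute the index of the fiber has a lift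
    that is integral exactly over the fiber and moves there like [H].  If [v]
    also has these properties, [floor_diff_const] makes the two functions grow
    by the same amount over a period. *)
Lemma degree_of_model (v : R -> R) (d k : int) (psi : circle R -> circle R) :
  continuous v -> (forall t, v (t + 1) = v t + d%:~R) ->
  (forall s t, (v t <= v s) = (H t <= H s)) ->
  (forall t, fiber H r (circle_exp t) <-> v t \is a Num.int) ->
  psi @^-1` [set circle_exp 0] = fiber H r ->
  (forall x, fiber H r x ->
    \forall y \near x, psi y = circle_div (g y) (f y)) ->
  has_degree psi k -> k = d.
Proof.
move=> cv vd vH vA psiA psif [P [cP PE Pk]].
have PA t : fiber H r (circle_exp t) <-> P t \is a Num.int.
  by rewrite -psiA /= PE; exact: circle_exp_eq1.
have vP t : (v t \is a Num.int) = (P t \is a Num.int).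
  apply/idP/idP.
    by move=> /vA /PA.
  by move=> /PA /vA.
have v1 : v 1 = v 0 + d%:~R by rewrite -vd add0r.
have P1 : P 1 = P 0 + k%:~R by rewrite -Pk add0r.
have := @floor_diff_const _ v P cv cP vP.
rewrite v1 P1 !floorDrz ?intr_int // !intrKfloor => fl.
suff : forall t, v t \is a Num.int ->
    \forall s \near t, (v t <= v s) = (P t <= P s)
  by move=> /fl; move: (Num.floor (v 0)) (Num.floor (P 0)) => x y; lia.
move=> t vt; have At : fiber H r (circle_exp t) by apply/vA.
have nE : \forall s \near t, psi (circle_exp s) =
    circle_div (g (circle_exp s)) (f (circle_exp s)).
  exact: (@circle_exp_continuous R t _ (psif _ At)).
(* [P - H] is integral near [t] and varies by less than 1 / 2, so it is
   constant near [t]. *)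
have e0 : (0 : R) < 4^-1 by rewrite invr_gt0.
have dP : \forall s \near t, `|P t - P s| < 4^-1
  by exact: (cvgr_dist_lt _ _ (cP t) _ e0).
have dH : \forall s \near t, `|H t - H s| < 4^-1
  by exact: (cvgr_dist_lt _ _ (@cH t) _ e0).
have D s : psi (circle_exp s) =
    circle_div (g (circle_exp s)) (f (circle_exp s)) -> P s - H s \is a Num.int.
  by rewrite PE fF gG circle_divE => /circle_exp_int.
have Dt : P t - H t \is a Num.int by apply: D; exact: (nbhs_singleton nE).
near=> s.
have Ds : P s - H s \is a Num.int by apply: D; near: s.
have : `|P t - P s| < 4^-1 by near: s.
have : `|H t - H s| < 4^-1 by near: s.
rewrite vH !ltr_norml => /andP[h1 h2] /andP[p1 p2].
have [m mE] := intrP Dt; have [n nEs] := intrP Ds.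
have mn : m = n.
  have lo : m%:~R < (n + 1)%:~R :> R by rewrite intrD1; lra.
  have hi : n%:~R < (m + 1)%:~R :> R by rewrite intrD1; lra.
  by move: lo hi; rewrite !ltr_int; lia.
by move: nEs; rewrite -mn -mE => e; apply/idP/idP; lra.
Unshelve. all: by end_near. Qed.

(** If [N <> 0] the model is an affine function of [H], scaled so that the
    translates [r + N * k] become the integers.  If [N = 0] the function [H] is
    periodic, and composing [H - r] with an increasing bijection of the line
    onto (-1, 1) leaves 0 as the only integral value; the model is periodic, so
    the index vanishes. *)
Lemma exists_model : exists v : R -> R, [/\ continuous v,
  forall t, v (t + 1) = v t + (sgz N)%:~R,
  forall s t, (v t <= v s) = (H t <= H s),
  forall t, fiber H r (circle_exp t) <-> v t \is a Num.int &
  N != 0 -> forall t, v t = (H t - r%:~R) / `|N|%:~R].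
Proof.
have [N0|N0] := eqVneq N 0; last first.
  have Np : 0 < `|N|%:~R :> R by rewrite ltr0z normr_gt0.
  have NN : `|N|%:~R != 0 :> R by rewrite gt_eqF.
  exists (fun t => (H t - r%:~R) / `|N|%:~R); split => //.
  - move=> t; apply: cvgMl; apply: cvgB; [exact: cH | exact: cvg_cst].
  - move=> t; rewrite HN addrAC mulrDl; congr (_ + _).
    by rewrite {1}[N]intEsg intrM -mulrA abszE divff ?mulr1.
  - by move=> s t; rewrite ler_pM2r ?invr_gt0 // lerD2r.
  - move=> t; split=> [/fiberP[k ->]|/intrP[k]].
      rewrite -intrB (_ : _ - r = sgz N * k * `|N|); last first.
        by rewrite {1}[N]intEsg abszE; ring.
      by rewrite intrM mulfK // intr_int.
    move/eqP; rewrite (can2_eq (divfK NN) (mulfK NN)) subr_eq => /eqP Hk.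
    apply/fiberP; exists (k * sgz N); rewrite Hk -intrM -intrD; congr _%:~R.
    by rewrite addrC -abszE abszEsg; ring.
pose th x : R := x / (1 + `|x|).
have thd (x : R) : 0 < 1 + `|x| by rewrite ltr_pwDl.
have th_lt1 (x : R) : `|th x| < 1.
  rewrite /th normrM normfV (gtr0_norm (thd x)) ltr_pdivrMr // mul1r.
  by rewrite ltrDr.
have th_le (x y : R) : (th x <= th y) = (x <= y).
  rewrite /th ler_pdivrMr // mulrAC ler_pdivlMr //.
  case: (ger0P x) => x0; case: (ger0P y) => y0; apply/idP/idP; nra.
exists (fun t => th (H t - r%:~R)); split => //.
- move=> t; apply: (@cvgM _ _ _ _ (fun t => H t - r%:~R)
    (fun t => (1 + `|H t - r%:~R|)^-1)).
    by apply: cvgB; [exact: cH | exact: cvg_cst].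
  apply: cvgV; first by rewrite gt_eqF.
  apply: cvgD; first exact: cvg_cst.
  apply: (@continuous_comp _ _ _ (fun t => H t - r%:~R) Num.norm);
    last exact: norm_continuous.
  by apply: cvgB; [exact: cH | exact: cvg_cst].
- by move=> t; rewrite HN N0 sgz0 !addr0.
- by move=> s t; rewrite th_le lerD2r.
- move=> t; split=> [/fiberP[k ->]|/intrP[k]].
    by rewrite N0 mul0r addr0 subrr /th mul0r.
  move=> thk; have : `|k%:~R| < 1 :> R by rewrite -thk.
  rewrite -intr_norm ltrz1 => k1.
  have k0 : k = 0 by lia.
  move: thk; rewrite k0 /th => /eqP; rewrite mulf_eq0 invr_eq0.
  rewrite (gt_eqF (thd _)) orbF.
  rewrite subr_eq0 => /eqP Hr; apply/fiberP; exists 0.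
  by rewrite Hr mulr0 addr0.
Qed.

(** The degree is forced by [degree_of_model].  If [N <> 0] a map as required
    by the definition of the index is obtained from the staircase; if [N = 0]
    the forced degree 0 is also the default value of the index. *)
Lemma coincidence_index_fiber :
  coincidence_index f g (fiber H r) = sgz N.
Proof.
have [v [cv vd vH vA vE]] := exists_model.
rewrite /coincidence_index; set P := (X in xget _ X).
have uniqP k : P k -> k = sgz N.
  move=> [psi [_ psiA psif psik]].
  exact: (degree_of_model cv vd vH vA psiA psif psik).
suff : N != 0 -> P (sgz N).
  move=> PN; case: xgetP => [k -> /uniqP //|noP].
  have [->|/PN /noP //] := eqVneq N 0; first by rewrite sgz0.
move=> N0; have M1 : 1 <= `|N|%:~R :> R by rewrite ler1z; lia.
have [W [cW WD Wi WE]] := exists_staircase M1.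
have WDz s (k : int) : W (s + k%:~R) = W s + k%:~R.
  by rewrite (lift_addz (F := W) (a := 1)) ?mul1r.
have cWv : continuous (W \o v).
  by move=> t; apply: continuous_comp; [exact: cv | exact: cW].
have [t|psi [cpsi psid psiE]] := circle_map_of_lift (a := sgz N) cWv.
  by rewrite /= vd WDz.
exists psi; split=> //.
  apply/seteqP; split=> z; have [t <-] := circle_exp_surj z => /=.
    by rewrite psiE => /circle_exp_eq1; rewrite /= Wi => /vA.
  by move=> /vA; rewrite psiE -Wi => /circle_exp_eq1.
move=> z Az; have [t tz] := circle_exp_surj z.
rewrite -tz in Az *; have /intrP[j vj] := (vA t).1 Az.
apply: near_circle_exp.
have e0 : 0 < (2 * `|N|%:~R)^-1 :> R.
  by rewrite invr_gt0 mulr_gt0 // (lt_le_trans _ M1).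
have : \forall s \near t, `|v t - v s| < (2 * `|N|%:~R)^-1.
  by exact: (cvgr_dist_lt _ _ (cv t) _ e0).
apply: filterS => s; rewrite vj distrC => /WE Ws.
rewrite psiE fF gG circle_divE; apply/circle_exp_eq.
exists (j - `|N| * j - r); rewrite /= Ws vE // mulrBr mulrCA divff; last first.
  by rewrite gt_eqF // (lt_le_trans _ M1).
by rewrite mulr1 /H !intrD !mulrNz intrM; ring.
Qed.

End IndexOfFiber.

(** * Arithmetic of the differences of powers *)

Section PowerDifferences.
Implicit Types (a b : int) (m n : nat).

Definition power_diff a b n : int := b ^+ n - a ^+ n.

(** Boosting from level [m] to level [n] multiplies winding numbers by this. *)
Definition boost_factor a b m n : int :=
  \sum_(i < n %/ m) b ^+ (n - m * i.+1) * a ^+ (m * i).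

Lemma boost_factorE a b m n : (m %| n)%N ->
  power_diff a b n = power_diff a b m * boost_factor a b m n.
Proof.
case/dvdnP=> q ->; rewrite mulnC /power_diff /boost_factor.
have [->|m0] := posnP m; first by rewrite mul0n !expr0 subrr mul0r.
rewrite mulKn // !exprM subrXX; congr (_ * _).
apply: eq_bigr => i _; rewrite -!exprM mulnBr.
by rewrite -subn1 mulnBr muln1 -subnDA mulnS.
Qed.

Lemma power_diff_neq0 a b m n : (m %| n)%N ->
  power_diff a b n != 0 -> power_diff a b m != 0.
Proof.
by move=> /(boost_factorE a b) ->; apply: contraNneq => ->; rewrite mul0r.
Qed.

Lemma coprime_power_diff a b m (q : int) : gcdz a b = 1 -> (0 < m)%N ->
  (q %| power_diff a b m)%Z -> coprimez q b.
Proof.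
move=> ab m0 qm; have dvd1 : (gcdz q b %| gcdz (a ^+ m) b)%Z.
  rewrite dvdz_gcd dvdz_gcdr andbT.
  have -> : a ^+ m = b ^+ m - power_diff a b m by rewrite /power_diff; ring.
  rewrite rpredB //; last by rewrite (dvdz_trans _ qm) ?dvdz_gcdl.
  by rewrite -(prednK m0) exprS dvdz_mulr ?dvdz_gcdr.
have /eqP am1 : coprimez (a ^+ m) b by apply: coprimezXl; apply/eqP.
by move: dvd1; rewrite am1 dvdz1.
Qed.

(** Write [power_diff a b (x + d)] as [b ^+ x * power_diff a b d] plus a multiple
    of [power_diff a b x]; as [q] is coprime to [b], a Bezout relation between
    [m] and [k] brings divisibility down to the gcd. *)
Lemma dvdz_power_diff_gcd a b m k (q : int) : gcdz a b = 1 ->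
  (0 < m)%N -> (0 < k)%N ->
  (q %| power_diff a b m)%Z -> (q %| power_diff a b k)%Z ->
  (q %| power_diff a b (gcdn m k))%Z.
Proof.
move=> ab m0 k0 qm qk.
have qb := coprime_power_diff ab m0 qm.
have [km kn E _] := egcdnP k m0.
have qmul j l : (q %| power_diff a b j)%Z -> (q %| power_diff a b (l * j))%Z.
  move=> qj; rewrite (@boost_factorE a b j) ?dvdn_mull //.
  exact: dvdz_mulr.
have := qmul _ km qm; have := qmul _ kn qk; rewrite E.
move: (kn * k)%N (gcdn m k) => x d qx.
have -> : power_diff a b (x + d) =
    b ^+ x * power_diff a b d + a ^+ d * power_diff a b x.
  by rewrite /power_diff !exprD; ring.
rewrite rpredDr; last by rewrite dvdz_mull.
by rewrite Gauss_dvdzr // coprimezXr.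
Qed.

(** Modulo 1, the hypothesis says that [beta / N_m] and [gamma / N_k] are the
    same rational number, where [N_j] is [power_diff a b j].  This number is
    killed by [N_m] and by [N_k], hence by their gcd, which is [N_d] up to sign
    because [a] and [b] are coprime; so it is of the form [delta / N_d]. *)
Lemma power_diff_gcd_lift a b m k n (beta gamma : int) : gcdz a b = 1 ->
  (0 < n)%N -> power_diff a b n != 0 -> (m %| n)%N -> (k %| n)%N ->
  (power_diff a b n %|
     boost_factor a b m n * beta - boost_factor a b k n * gamma)%Z ->
  exists delta : int,
    (power_diff a b m %| beta - boost_factor a b (gcdn m k) m * delta)%Z /\
    (power_diff a b k %| gamma - boost_factor a b (gcdn m k) k * delta)%Z.
Proof.
move=> ab n0 Nn mn kn; set d := gcdn m k.
have m0 : (0 < m)%N := dvdn_gt0 n0 mn.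
have k0 : (0 < k)%N := dvdn_gt0 n0 kn.
have dm : (d %| m)%N := dvdn_gcdl _ _.
have dk : (d %| k)%N := dvdn_gcdr _ _.
have Nd : power_diff a b d != 0.
  by apply: power_diff_neq0 Nn; exact: dvdn_trans mn.
have Nm := power_diff_neq0 mn Nn; have Nk := power_diff_neq0 kn Nn.
have em := boost_factorE a b mn; have ek := boost_factorE a b kn.
have fm := boost_factorE a b dm; have fk := boost_factorE a b dk.
set M := boost_factor a b d m in fm *; set K := boost_factor a b d k in fk *.
set S := boost_factor a b m n in em *; set T := boost_factor a b k n in ek *.
set e := power_diff a b d in Nd fm fk.
have cMK : coprimez M K.
  have : (e * gcdz M K %| e * 1)%Z.
    rewrite mulr1; apply: dvdz_power_diff_gcd => //.
      by rewrite fm dvdz_mul2l // dvdz_gcdl.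
    by rewrite fk dvdz_mul2l // dvdz_gcdr.
  by rewrite dvdz_mul2l // dvdz1.
move=> /dvdzP[z zE].
have main : (beta - power_diff a b m * z) * K = gamma * M.
  apply: (mulfI Nn); apply: (mulfI Nd).
  transitivity (power_diff a b m * power_diff a b k *
    (S * beta - power_diff a b n * z)).
    by rewrite em fk; ring.
  have -> : S * beta - power_diff a b n * z = T * gamma by lia.
  by rewrite fm ek; ring.
have /dvdzP[delta dE] : (M %| beta - power_diff a b m * z)%Z.
  by rewrite -(Gauss_dvdzl _ cMK) main dvdz_mull.
exists delta; split.
  by apply/dvdzP; exists z; rewrite [M * _]mulrC -dE; ring.
apply/dvdzP; exists 0; rewrite mul0r.
have M0 : M != 0 by move: Nm; rewrite fm mulf_eq0 negb_or => /andP[].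
apply/eqP; rewrite subr_eq0 -(inj_eq (mulIf M0)) -main dE; apply/eqP; ring.
Qed.

Lemma power_diff_odd a b n : odd n -> a != b -> power_diff a b n != 0.
Proof.
move=> no; apply: contraNneq => /eqP; rewrite subr_eq0 => /eqP ab.
have n0 : (0 < n)%N by case: n no {ab}.
have /eqP : `|b| = `|a|.
  by apply/(pexpIrn n0); rewrite ?nnegrE // -!normrX ab.
rewrite eqr_norm2 eq_sym => /orP[//|/eqP ba].
have : b ^+ n = 0.
  by move: ab; rewrite ba exprNn -signr_odd no mulN1r; lia.
by move/eqP; rewrite expf_eq0 n0 ba oppr_eq0 => /eqP ->; rewrite oppr0.
Qed.

(** Let [p] be the gcd of [a] and [b].  The number [1 / p ^ m] is killed by [N_m]
    and by [N_k] for every [k >= m], but not by [N_1] once [p ^ m] exceeds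
    the absolute value of [N_1].  The levels are consecutive odd numbers: these
    are coprime, and odd powers are injective, so that no [N_n] vanishes, even if
    [a = - b]. *)
Lemma power_diff_no_lift a b : a != b -> gcdz a b != 1 ->
  exists m k (beta gamma : int), let n := (m * k)%N in
    [/\ (0 < n)%N, gcdn m k = 1%N, power_diff a b n != 0,
      boost_factor a b m n * beta = boost_factor a b k n * gamma &
      forall delta, ~ (power_diff a b m %|
        beta - boost_factor a b 1 m * delta)%Z].
Proof.
move=> ab p1; set p := gcdz a b in p1.
have p0 : p != 0.
  apply: contraNneq ab; rewrite /p => /eqP.
  by rewrite gcdz_eq0 => /andP[/eqP-> /eqP->].
pose e := power_diff a b 1; pose j := `|e|%N.
have e0 : e != 0 by exact: power_diff_odd.
have odd2 i : odd i.*2.+1 by rewrite /= odd_double.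
pose m := j.*2.+1; pose k := j.+1.*2.+1.
have Nm : power_diff a b m != 0 by exact: (power_diff_odd (odd2 j)).
have Nn : power_diff a b (m * k) != 0.
  by apply: power_diff_odd; rewrite // oddM /m /k !odd2.
have pP i : (m <= i)%N -> (p ^+ m %| power_diff a b i)%Z.
  move=> mi; apply: dvdz_trans (dvdz_exp2l p mi) _.
  by rewrite rpredB // dvdz_exp2r // (dvdz_gcdl, dvdz_gcdr).
have /dvdzP[beta betaE] := pP m (leqnn m).
have mk : (m <= k)%N by rewrite /m /k; lia.
have /dvdzP[gamma gammaE] := pP k mk.
have pm0 : p ^+ m != 0 by rewrite expf_neq0.
exists m, k, beta, gamma => n; split.
- by rewrite /n muln_gt0.
- have -> : k = (m + 2)%N by rewrite /m /k; lia.
  apply/eqP; rewrite gcdnDl -/(coprime m 2) coprime_sym coprime2n.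
  exact: odd2.
- by [].
- apply: (mulIf pm0); rewrite -!mulrA -betaE -gammaE mulrC [RHS]mulrC.
  rewrite -(boost_factorE a b (dvdn_mulr k (dvdnn m))).
  by rewrite -(boost_factorE a b (dvdn_mull m (dvdnn k))).
- move=> delta /dvdzP[z zE].
  have eE : e = p ^+ m * (delta + z * e).
    apply: (mulfI Nm); have em : power_diff a b m = e * boost_factor a b 1 m.
      by rewrite -boost_factorE.
    have -> : power_diff a b m * e = beta * p ^+ m * e by rewrite -betaE.
    have -> : beta = z * power_diff a b m + boost_factor a b 1 m * delta by lia.
    by rewrite [in z * _]em [in RHS]em; ring.
  have : (p ^+ m %| e)%Z by rewrite eE dvdz_mulr.
  rewrite dvdzE => /dvdn_leq; rewrite lt0n absz_eq0 e0 => /(_ isT).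
  rewrite abszX.
  have p2 : (1 < `|p|)%N.
    by move: p0 p1; rewrite /p /gcdz; move: (gcdn _ _) => x; lia.
  have := ltn_expl m p2; rewrite -/j /m; lia.
Qed.

End PowerDifferences.

(** * Reidemeister classes as residue classes *)

Section Classes.
Context {R : realType}.
Variables (f g : circle R -> circle R) (F G : R -> R) (a b : int) (t0 : R).
Hypotheses (cF : continuous F) (cG : continuous G).
Hypotheses (fF : forall t, f (circle_exp t) = circle_exp (F t))
           (gG : forall t, g (circle_exp t) = circle_exp (G t)).
Hypotheses (Fa : forall t, F (t + 1) = F t + a%:~R)
           (Gb : forall t, G (t + 1) = G t + b%:~R).
Hypotheses (Ft0 : F t0 = t0) (Gt0 : G t0 = t0).
Implicit Types (s t : R) (m n k : nat) (u v w : int).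
Implicit Types (alpha beta gamma : R -> circle R).

Local Notation x0 := (circle_exp t0).
Local Notation N := (power_diff a b).

Lemma iter_lift (h : circle R -> circle R) (H : R -> R) n :
  (forall t, h (circle_exp t) = circle_exp (H t)) ->
  forall t, iter n h (circle_exp t) = circle_exp (iter n H t).
Proof. by move=> hH t; elim: n => //= n ->. Qed.

Lemma iter_continuous (H : R -> R) n : continuous H -> continuous (iter n H).
Proof.
move=> cH; elim: n => [|n IH] t; first exact: cvg_id.
by apply: (@continuous_comp _ _ _ (iter n H) H); [exact: IH | exact: cH].
Qed.

Lemma iter_degree (H : R -> R) d n : (forall t, H (t + 1) = H t + d%:~R) ->
  forall t, iter n H (t + 1) = iter n H t + (d ^+ n)%:~R.
Proof.
by move=> Hd t; elim: n => //= n ->; rewrite (lift_addz Hd) exprS.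
Qed.

Lemma iter_fixed (H : R -> R) n t : H t = t -> iter n H t = t.
Proof. by move=> Ht; elim: n => //= n ->. Qed.

Definition gap n t : R := iter n G t - iter n F t.

Lemma gap_degree n t : gap n (t + 1) = gap n t + (N n)%:~R.
Proof.
rewrite /gap (iter_degree _ Fa) (iter_degree _ Gb) /power_diff intrB.
by rewrite opprD addrACA.
Qed.

(** The identification of the fundamental group with the integers, as a
    relation: [alpha] is a loop at [x0] of winding number [w]. *)
Definition winds alpha w := has_lift alpha t0 (t0 + w%:~R).

Lemma winds_path alpha w : winds alpha w -> is_path x0 x0 alpha.
Proof. by move/has_lift_path; rewrite circle_expD_int. Qed.

Lemma path_winds alpha : is_path x0 x0 alpha -> exists w, winds alpha w.
Proof.
move=> pa; have [v av] := path_has_lift pa erefl.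
have [_ _] := has_lift_path av; have [_ _ ->] := pa.
by move/esym/circle_exp_eq => [w vw]; exists w; rewrite /winds -vw.
Qed.

Lemma winds_exists w : exists alpha, winds alpha w.
Proof. exact: has_lift_exists. Qed.

Lemma winds_homotopic alpha beta u v : winds alpha u -> winds beta v ->
  path_homotopic alpha beta <-> u = v.
Proof.
move=> au bv; rewrite (path_homotopicP au bv); split=> [/addrI/eqP|-> //].
by rewrite eqr_int => /eqP.
Qed.

Lemma winds_cat alpha beta u v : winds alpha u -> winds beta v ->
  winds (path_cat alpha beta) (u + v).
Proof.
move=> au /(has_lift_shift u); rewrite -addrA -intrD [v + u]addrC.
exact: has_lift_cat.
Qed.

Lemma winds_rev alpha u : winds alpha u -> winds (path_rev alpha) (- u).
Proof.
by move/has_lift_rev/(has_lift_shift (- u)); rewrite /winds mulrNz addrK.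
Qed.

Lemma winds_iter (h : circle R -> circle R) (H : R -> R) d n alpha u :
  continuous H -> (forall t, h (circle_exp t) = circle_exp (H t)) ->
  (forall t, H (t + 1) = H t + d%:~R) -> H t0 = t0 ->
  winds alpha u -> winds (iter n h \o alpha) (d ^+ n * u).
Proof.
move=> cH hH Hd Ht0.
move/(has_lift_map (iter_continuous (n:=n) cH) (iter_lift n hH)).
by rewrite (lift_addz (iter_degree n Hd)) iter_fixed.
Qed.

Lemma reidemeister_equivP n alpha beta u v : winds alpha u -> winds beta v ->
  reidemeister_equiv f g x0 n alpha beta <-> (N n %| u - v)%Z.
Proof.
move=> au bv.
have wind gamma c : winds gamma c ->
    winds (path_cat (iter n g \o gamma)
      (path_cat beta (iter n f \o path_rev gamma))) (v + N n * c).
  move=> gc; have -> : v + N n * c = b ^+ n * c + (v + a ^+ n * - c).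
    by rewrite /power_diff; ring.
  apply: winds_cat; first exact: (winds_iter n cG gG Gb Gt0 gc).
  apply: (winds_cat bv); exact: (winds_iter n cF fF Fa Ft0 (winds_rev gc)).
split=> [[gamma /path_winds[c gc]]|/dvdzP[c uv]].
  rewrite (winds_homotopic au (wind _ _ gc)) => ->.
  by rewrite addrC addKr dvdz_mulr.
have [gamma gc] := winds_exists c; exists gamma; first exact: winds_path gc.
by rewrite (winds_homotopic au (wind _ _ gc)); lia.
Qed.

(** The Reidemeister classes of level [n] are the integers modulo [N n]. *)
Lemma reidemeister_class_eq n alpha beta u v : winds alpha u -> winds beta v ->
  reidemeister_class f g x0 n alpha = reidemeister_class f g x0 n beta <->
  (N n %| u - v)%Z.
Proof.
move=> au bv; split=> [ab|uv].
  have : reidemeister_class f g x0 n beta beta.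
    split; first exact: winds_path bv.
    by rewrite (reidemeister_equivP _ bv bv) subrr dvdz0.
  by rewrite -ab => -[_]; rewrite (reidemeister_equivP _ au bv).
apply/seteqP; split=> gamma [/[dup] pg /path_winds[w gw]];
  rewrite (reidemeister_equivP _ au gw, reidemeister_equivP _ bv gw) => dv;
  split => //;
  rewrite (reidemeister_equivP _ au gw, reidemeister_equivP _ bv gw).
- have -> : v - w = (u - w) - (u - v) by rewrite opprB [RHS]addrC addrA subrK.
  by rewrite rpredB.
- have -> : u - w = (u - v) + (v - w) by rewrite addrA subrK.
  by rewrite rpredD.
Qed.

Lemma winds_boost m n alpha w : winds alpha w ->
  winds (boost f g x0 m n alpha) (boost_factor a b m n * w).
Proof.
move=> aw; rewrite /boost /boost_factor mulr_suml.
rewrite -(big_mkord xpredT (fun i => b ^+ (n - m * i.+1) * a ^+ (m * i) * w)).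
rewrite /index_iota subn0; elim: (iota _ _) => [|i r IH].
  by rewrite big_nil /= /winds addr0; exact: has_lift_cst.
rewrite big_cons /=; apply: winds_cat IH; rewrite -mulrA.
exact: (winds_iter _ cG gG Gb Gt0 (winds_iter _ cF fF Fa Ft0 aw)).
Qed.

(** The lifts of the two image paths, moved to a common start, have a common end
    exactly if [gap n] takes the same value at both ends of the lifted path. *)
Lemma nielsen_equivP n s t u : gap n s = u%:~R ->
  nielsen_equiv (R := R) f g n (circle_exp s) (circle_exp t) <->
  exists k : int, gap n (t + k%:~R) = u%:~R.
Proof.
move=> su.
have liftP c (v : R) : has_lift c s v ->
    path_homotopic (iter n f \o c) (iter n g \o c) <-> gap n v = u%:~R.
  move=> cv.
  have cf := has_lift_map (iter_continuous (n:=n) cF) (iter_lift n fF) cv.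
  have cg := has_lift_map (iter_continuous (n:=n) cG) (iter_lift n gG) cv.
  have := has_lift_shift u cf.
  rewrite (_ : iter n F s + u%:~R = iter n G s); last first.
    by rewrite -su /gap addrC subrK.
  move=> cf'; rewrite (path_homotopicP cf' cg) /gap.
  by split=> [<-|<-]; [rewrite addrC addKr | rewrite addrC subrK].
split=> [[c pc /= cH]|[k tk]].
  have [v cv] := path_has_lift pc erefl; move/(liftP _ _ cv) : cH => vu.
  have [_ _ vt] := has_lift_path cv; have [_ _ ct] := pc.
  by have /circle_exp_eq[k vE] := etrans (esym vt) ct; exists k; rewrite -vE.
have [c cv] := has_lift_exists s (t + k%:~R); exists c.
  by rewrite -(circle_expD_int t k); exact: has_lift_path.
exact/(liftP _ _ cv).
Qed.

Lemma coincidenceP n t : coincidences f g n (circle_exp t) <->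
  exists u, gap n t = u%:~R.
Proof.
rewrite /coincidences /= (iter_lift n fF) (iter_lift n gG) /gap.
split=> [/esym/circle_exp_eq[u ->]|[u tu]].
  by exists u; rewrite addrC addKr.
by apply/esym/circle_exp_eq; exists u; rewrite -tu addrC subrK.
Qed.

Lemma nielsen_class_fiber n s u : gap n s = u%:~R ->
  [set y | coincidences f g n y /\
           nielsen_equiv (R := R) f g n (circle_exp s) y] =
  fiber (gap n) u.
Proof.
move=> su; apply/seteqP; split=> y; have [t <-] := circle_exp_surj y.
  move=> [_ /(nielsen_equivP _ su)[k tk]].
  by exists (t + k%:~R) => //; rewrite circle_expD_int.
move=> [t' /= tu <-]; split; first by apply/coincidenceP; exists u.
by apply/(nielsen_equivP _ su); exists 0; rewrite addr0.
Qed.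

Lemma nielsen_class_index n A : nielsen_class (R := R) f g n A ->
  coincidence_index (iter n f) (iter n g) A = sgz (N n).
Proof.
move=> [x + ->]; have [s <-] := circle_exp_surj x => /coincidenceP[u su].
rewrite (nielsen_class_fiber su).
apply: (coincidence_index_fiber u (iter_continuous (n:=n) cF)
  (iter_continuous (n:=n) cG)
  (iter_lift n fF) (iter_lift n gG)).
exact: gap_degree.
Qed.

(** If [N n] is not zero then every Reidemeister class comes from a Nielsen
    class, because [gap n] is unbounded in both directions and hence takes every
    integral value. *)
Lemma gap_surj n u : N n != 0 -> exists s, gap n s = u%:~R.
Proof.
move=> Nn.
have cgap : continuous (gap n).
  by move=> t; apply: cvgB; exact: iter_continuous.
have gap0 : gap n t0 = 0 by rewrite /gap !iter_fixed // subrr.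
have gapk (k : int) : gap n (t0 + k%:~R) = (N n * k)%:~R.
  by rewrite (lift_addz (gap_degree n)) gap0 add0r.
have M1 : 1 <= `|N n| by rewrite -gtz0_ge1 normr_gt0.
pose k := sgz (N n) * u.
have kE : N n * k = `|N n| * u.
  by rewrite /k mulrA [N n * _]mulrC -abszEsg abszE.
have [||s _ sE] := @IVT R (fun t => gap n (t0 + t * k%:~R)) 0 1 u%:~R ler01.
- apply: continuous_subspaceT => t.
  apply: (@continuous_comp _ _ _ (fun t => t0 + t * k%:~R) (gap n));
    last exact: cgap.
  apply: (@cvgD _ _ _ _ _ (fun=> t0) (fun t => t * k%:~R));
    first exact: cvg_cst.
  exact: mulrr_continuous.
- rewrite mul0r addr0 mul1r gap0 gapk kE intrM ge_min le_max.
  have M1R : 1 <= `|N n|%:~R :> R by rewrite ler1z.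
  have [u0|u0] := leP 0 (u%:~R : R).
    by rewrite /= ler_peMl ?orbT.
  by rewrite /= (ltW u0) andbT; nra.
by exists (t0 + s * k%:~R).
Qed.

Lemma nielsen_to_reidemeister_gap n s alpha u :
  gap n s = u%:~R -> winds alpha u ->
  nielsen_to_reidemeister f g x0 n (fiber (gap n) u)
    (reidemeister_class f g x0 n alpha).
Proof.
move=> su au; have [c cs] := has_lift_exists t0 s.
exists (circle_exp s), c; split; [by exists s|exact: has_lift_path|].
have cf := has_lift_map (iter_continuous (n:=n) cF) (iter_lift n fF)
  (has_lift_rev cs).
have cg := has_lift_map (iter_continuous (n:=n) cG) (iter_lift n gG) cs.
rewrite (iter_fixed _ Gt0) in cg; rewrite (iter_fixed _ Ft0) in cf.
have := has_lift_shift u cf.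
rewrite (_ : iter n F s + u%:~R = iter n G s); last first.
  by rewrite -su /gap addrC subrK.
move=> /(has_lift_cat cg) cu.
by apply/(reidemeister_class_eq _ au cu); rewrite subrr dvdz0.
Qed.

(** All Nielsen classes of level [n] have index [sgz (N n)], and by [gap_surj]
    every Reidemeister class is the image of one if this is not 0; so whether a
    class is essential depends on its level only. *)
Lemma essentialP n C :
  essential f g x0 n C <-> reidemeister f g x0 n C /\ N n != 0.
Proof.
rewrite /essential /reidemeister_index; set P := (X in xget _ X).
have PN i : P i -> i = sgz (N n).
  by move=> [A [/nielsen_class_index <- _ ->]].
split=> [[rC]|[rC Nn]].
  case: xgetP => [i -> /PN -> Ns|//]; split=> //.
  by apply/eqP => N0; apply: Ns; rewrite N0 sgz0.
split=> //; have [alpha /path_winds[u au] CE] := rC.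
have [s su] := gap_surj u Nn.
have Pex : exists i, P i.
  eexists; exists (fiber (gap n) u); split; [| |reflexivity].
    exists (circle_exp s); first by apply/coincidenceP; exists u.
    by rewrite (nielsen_class_fiber su).
  by rewrite CE; exact: (nielsen_to_reidemeister_gap su au).
by rewrite (PN _ (xgetPex 0 Pex)) => /eqP; rewrite sgz_eq0 (negbTE Nn).
Qed.

(** * Reducibility *)

Lemma essentially_reducible_circle : essentially_reducible f g x0.
Proof.
move=> n D m C n0 /essentialP[_ Nn] [mn [alpha [pa -> _]]].
apply/essentialP; split; first by exists alpha.
exact: power_diff_neq0 Nn.
Qed.

Lemma reducible_to_gcd_coprime : gcdz a b = 1 ->
  essentially_reducible_to_gcd f g x0.
Proof.
move=> ab; split; first exact: essentially_reducible_circle.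
move=> n D m B k C n0 /essentialP[_ Nn] _ _.
move=> [mn [beta [/path_winds[u bu] -> DB]]].
move=> [kn [gamma [/path_winds[v gv] -> DC]]].
have := DC; rewrite DB => /(reidemeister_class_eq _ (winds_boost _ _ bu)
  (winds_boost _ _ gv)) dv.
have [w [wu wv]] := power_diff_gcd_lift ab n0 Nn mn kn dv.
have [delta dw] := winds_exists w.
have dP := winds_path dw.
exists (reidemeister_class f g x0 (gcdn m k) delta); split.
- apply/essentialP; split; first by exists delta.
  by apply: power_diff_neq0 Nn; apply: dvdn_trans mn; exact: dvdn_gcdl.
- split; first exact: dvdn_gcdl.
  exists delta; split => //.
  exact/(reidemeister_class_eq _ bu (winds_boost _ _ dw)).
- split; first exact: dvdn_gcdr.
  exists delta; split => //.
  exact/(reidemeister_class_eq _ gv (winds_boost _ _ dw)).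
Qed.

Lemma coprime_of_reducible_to_gcd : a != b ->
  essentially_reducible_to_gcd f g x0 -> gcdz a b = 1.
Proof.
move=> ab [_ red]; apply/eqP; apply: contrapT => /negP ab1.
have [m [k [u [v /= [n0 mk Nn uv nolift]]]]] := power_diff_no_lift ab ab1.
have [beta bu] := winds_exists u; have [gamma gv] := winds_exists v.
have pb := winds_path bu; have pg := winds_path gv.
have mn : (m %| m * k)%N := dvdn_mulr k (dvdnn m).
have kn : (k %| m * k)%N := dvdn_mull m (dvdnn k).
have wb := winds_boost m (m * k) bu; have wg := winds_boost k (m * k) gv.
pose D := reidemeister_class f g x0 (m * k) (boost f g x0 m (m * k) beta).
have [||||| E []] := red (m * k)%N D m (reidemeister_class f g x0 m beta) k
  (reidemeister_class f g x0 k gamma) n0.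
- apply/essentialP; split => //; exists (boost f g x0 m (m * k) beta) => //.
  exact: winds_path wb.
- apply/essentialP; split; first by exists beta.
  exact: power_diff_neq0 Nn.
- apply/essentialP; split; first by exists gamma.
  exact: power_diff_neq0 Nn.
- by split => //; exists beta.
- split => //; exists gamma; split => //.
  by apply/(reidemeister_class_eq _ wb wg); rewrite uv subrr dvdz0.
rewrite mk => _ [_ [delta [/path_winds[w dw] _ Edelta]]] _.
apply: (nolift w).
exact/(reidemeister_class_eq _ bu (winds_boost 1 m dw)).
Qed.

End Classes.

(** The lift given by the degree fixes the base point up to an integer, which can
    be subtracted. *)
Lemma lift_fixing {R : realType} (h : circle R -> circle R) (d : int) (t0 : R) :
  has_degree h d -> h (circle_exp t0) = circle_exp t0 ->
  exists H : R -> R, [/\ continuous H,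
    forall t, h (circle_exp t) = circle_exp (H t),
    forall t, H (t + 1) = H t + d%:~R & H t0 = t0].
Proof.
move=> [H [cH hH Hd]]; rewrite hH => /circle_exp_eq[k Hk].
exists (fun t => H t + (- k)%:~R); split=> [t|t|t|].
- by apply: (@cvgD _ _ _ _ _ H (fun=> _)); [exact: cH | exact: cvg_cst].
- by rewrite circle_expD_int.
- by rewrite Hd addrAC.
- by rewrite Hk mulrNz addrK.
Qed.

Theorem theorem4p13 (R : realType) (f g : circle R -> circle R)
    (x0 : circle R) (a b : int)
    (cf : continuous f) (cg : continuous g)
    (fx0 : f x0 = x0) (gx0 : g x0 = x0)
    (fa : has_degree f a) (gb : has_degree g b)
    (hab : a = b -> `|a|%N = 1%N) :
  essentially_reducible_to_gcd f g x0 <-> gcdz a b = 1.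
Proof.
have [t0 t0E] := circle_exp_surj x0; rewrite -t0E in fx0 gx0 *.
have [F [cF fF Fa Ft0]] := lift_fixing fa fx0.
have [G [cG gG Gb Gt0]] := lift_fixing gb gx0.
split; last exact: (reducible_to_gcd_coprime cF cG fF gG Fa Gb Ft0 Gt0).
have [ab _|ab] := eqVneq a b; last first.
  exact: (coprime_of_reducible_to_gcd cF cG fF gG Fa Gb Ft0 Gt0).
by rewrite /gcdz -ab gcdnn hab.
Qed.
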